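(* Let $p$ be the mesh pattern $(12,R)$ with $R=\{(0,1),(0,2),(1,1),(1,2),(2,0)\}$, let $E(t,u)=\sum_{n\ge0}t^n\sum_{\sigma\in K_n}u^{p(\sigma)}$, and let $P(t)=\sum_{n\ge0}|K_n(p)|t^n$. Then $$P(t)=1+t+\frac{1}{1+t}-\frac{1}{A(t)},$$ $$E(t,u)=\frac{(-1+u)(1+ut)(1+t)+\big(2-u+t(2+t+u-u^2)\big)A(t)}{u(1+ut)(1+t)+(1-u)(1+t+ut)A(t)}.$$ The initial terms of $E(t,u)$ are $1+t+2t^4+(10+4u)t^5+(68+20u+2u^2)t^6+(500+136u+10u^2)t^7+(4170+1004u+68u^2)t^8+\cdots$.
   Context: A permutation $\sigma=\sigma_1\cdots\sigma_n$ of $\{1,\dots,n\}$ is a king permutation if $|\sigma_{i+1}-\sigma_i|>1$ for all $1\le i\le n-1$. $K_n$ is the set of king permutations of length $n$ ($K_0$ = the empty permutation, $K_1=\{1\}$) and $A(t)=\sum_{n\ge0}|K_n|t^n$ (known to equal $\sum_{n\ge0}n!\,t^n(1-t)^n/(1+t)^n$). For a mesh pattern $p=(12,R)$ with $R\subseteq\{0,1,2\}^2$, an occurrence of $p$ in $\sigma\in S_n$ is a pair of positions $i_1<i_2$ with $\sigma_{i_1}<\sigma_{i_2}$ such that for every $(x,y)\in R$ there is no position $m$ with $i_x<m<i_{x+1}$ and $v_y<\sigma_m<v_{y+1}$, where $i_0=0$, $i_3=n+1$, $v_0=0$, $v_1=\sigma_{i_1}$, $v_2=\sigma_{i_2}$,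 $v_3=n+1$ (first coordinate of a box indexes positions, second values). $p(\sigma)$ is the number of occurrences of $p$ in $\sigma$; $K_n(p)$ is the set of king $n$-permutations with $p(\sigma)=0$. *)

(* Defs.v *)
From HB Require Import structures.
From mathcomp Require Import all_boot all_order all_algebra all_fingroup.
From mathcomp Require Import boolp.

Set Implicit Arguments.
Unset Strict Implicit.
Unset Printing Implicit Defensive.

Import Order.TTheory GRing.Theory Num.Theory.
Local Open Scope ring_scope.

(* [fps R] is R[[t]] with the Cauchy product; the wrapper keeps it apart from
   [nat -> R], whose library ring structure is pointwise. *)
Record fps (R : Type) : Type := Fps { fcoef : nat -> R }.

HB.instance Definition _ (R : Type) := gen_eqMixin (fps R).
HB.instance Definition _ (R : Type) := gen_choiceMixin (fps R).

Lemma fpsP (R : Type) (f g : fps R) : fcoef f =1 fcoef g <-> f = g.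
Proof. by case: f g => [f] [g]; split=> [/funext /= ->|[->]]. Qed.

Section FpsZmod.
Variable R : zmodType.
Implicit Types f g h : fps R.

Definition fps_zero : fps R := Fps (fun=> 0).
Definition fps_opp f : fps R := Fps (fun n => - fcoef f n).
Definition fps_add f g : fps R := Fps (fun n => fcoef f n + fcoef g n).

Lemma fps_addA : associative fps_add.
Proof. by move=> f g h; apply/fpsP => n /=; rewrite addrA. Qed.
Lemma fps_addC : commutative fps_add.
Proof. by move=> f g; apply/fpsP => n /=; rewrite addrC. Qed.
Lemma fps_add0 : left_id fps_zero fps_add.
Proof. by move=> f; apply/fpsP => n /=; rewrite add0r. Qed.
Lemma fps_addN : left_inverse fps_zero fps_opp fps_add.
Proof. by move=> f; apply/fpsP => n /=; rewrite addNr. Qed.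

HB.instance Definition _ :=
  GRing.isZmodule.Build (fps R) fps_addA fps_addC fps_add0 fps_addN.
End FpsZmod.

Section FpsRing.
Variable R : comNzRingType.
Implicit Types f g h : fps R.

Definition fpsC (c : R) : fps R := Fps (fun n => if n == 0%N then c else 0).
Definition fpsX : fps R := Fps (fun n => (n == 1%N)%:R).
Definition fps_mul f g : fps R :=
  Fps (fun n => \sum_(i < n.+1) fcoef f i * fcoef g (n - i)%N).

Let trunc N f : {poly R} := \poly_(i < N) fcoef f i.

Let fps_mul_trunc N f g n :
  (n < N)%N -> fcoef (fps_mul f g) n = (trunc N f * trunc N g)`_n.
Proof.
move=> ltnN; rewrite coefM /=; apply: eq_bigr => i _.
have leiN : (i < N)%N by rewrite (leq_trans (ltn_ord i)).
have leniN : (n - i < N)%N by rewrite (leq_ltn_trans _ ltnN) ?leq_subr.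
by rewrite !coef_poly leiN leniN.
Qed.

Lemma fps_mulC : commutative fps_mul.
Proof.
by move=> f g; apply/fpsP => n; rewrite !(@fps_mul_trunc n.+1) // mulrC.
Qed.

Lemma fps_mulA : associative fps_mul.
Proof.
move=> f g h; apply/fpsP => n; pose T := trunc n.+1.
have -> : fcoef (fps_mul f (fps_mul g h)) n = (T f * (T g * T h))`_n.
  rewrite (@fps_mul_trunc n.+1) // !coefM; apply: eq_bigr => i _.
  have ltni : (n - i < n.+1)%N by rewrite ltnS leq_subr.
  rewrite [(trunc _ (fps_mul _ _))`__]coef_poly ltni.
  by rewrite (fps_mul_trunc _ _ ltni) coefM.
rewrite mulrA (@fps_mul_trunc n.+1) // !coefM; apply: eq_bigr => i _.
rewrite [(trunc _ (fps_mul _ _))`__]coef_poly ltn_ord.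
by rewrite (fps_mul_trunc _ _ (ltn_ord i)) coefM.
Qed.

Lemma fps_mul1 : left_id (fpsC 1) fps_mul.
Proof.
move=> f; apply/fpsP => n /=.
by rewrite big_ord_recl /= mul1r subn0 big1 ?addr0 // => i _; rewrite mul0r.
Qed.

Lemma fps_mulDl : left_distributive fps_mul +%R.
Proof.
move=> f g h; apply/fpsP => n /=; rewrite -big_split.
by apply: eq_bigr => i _; rewrite mulrDl.
Qed.

Lemma fps_one_neq0 : fpsC 1 != 0.
Proof. by apply/eqP => /fpsP/(_ 0%N)/eqP; rewrite oner_eq0. Qed.

HB.instance Definition _ := GRing.Zmodule_isComNzRing.Build (fps R)
  fps_mulA fps_mulC fps_mul1 fps_mulDl fps_one_neq0.

Lemma fcoefD f g n : fcoef (f + g) n = fcoef f n + fcoef g n. Proof. by []. Qed.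
Lemma fcoefN f n : fcoef (- f) n = - fcoef f n. Proof. by []. Qed.
Lemma fcoefM f g n :
  fcoef (f * g) n = \sum_(i < n.+1) fcoef f i * fcoef g (n - i)%N.
Proof. by []. Qed.
Lemma fcoef1 n : fcoef (1 : fps R) n = (n == 0%N)%:R. Proof. by case: n. Qed.
Lemma fcoef0M f g : fcoef (f * g) 0 = fcoef f 0 * fcoef g 0.
Proof. by rewrite fcoefM big_ord1. Qed.
End FpsRing.

Section FpsUnitRing.
Variable R : comUnitRingType.
Implicit Types f g : fps R.

Definition fps_unit : pred (fps R) :=
  fun f => fcoef f 0 \is a GRing.unit.

(* The first n coefficients g_0, ..., g_(n-1) of the solution g of f * g = 1. *)
Fixpoint fps_inv_seq f n : seq R :=
  if n is m.+1 then
    let s := fps_inv_seq f m in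
    rcons s ((fcoef f 0)^-1 *
             ((m == 0%N)%:R - \sum_(i < m) fcoef f (m - i)%N * s`_i))
  else [::].

Definition fps_inv f : fps R :=
  if fps_unit f then Fps (fun n => (fps_inv_seq f n.+1)`_n) else f.

Lemma size_fps_inv_seq f n : size (fps_inv_seq f n) = n.
Proof. by elim: n => //= n IHn; rewrite size_rcons IHn. Qed.

Lemma nth_fps_inv_seq f m n :
  (n < m)%N -> (fps_inv_seq f m)`_n = (fps_inv_seq f n.+1)`_n.
Proof.
elim: m => // m IHm; rewrite ltnS leq_eqVlt => /predU1P[-> //|ltnm].
by rewrite {1}/fps_inv_seq -/fps_inv_seq nth_rcons size_fps_inv_seq ltnm IHm.
Qed.

Lemma fps_mulVx : {in fps_unit, left_inverse 1 fps_inv *%R}.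
Proof.
move=> f Uf; apply/fpsP => n; rewrite fcoefM fcoef1 /fps_inv.
have {}Uf : fcoef f 0 \is a GRing.unit := Uf.
rewrite /fps_unit Uf big_ord_recr /= subnn.
rewrite nth_rcons size_fps_inv_seq ltnn eqxx.
rewrite mulrAC mulVr // mul1r addrCA -sumrB big1 ?addr0 // => i _ /=.
have := nth_fps_inv_seq f (ltn_ord i); rewrite /= => ->.
by rewrite mulrC subrr.
Qed.

Lemma fps_unitPl f g : g * f = 1 -> fps_unit f.
Proof.
move/fpsP/(_ 0%N); rewrite fcoef0M fcoef1 /= => gf1.
by apply/unitrP; exists (fcoef g 0); rewrite [fcoef f 0 * _]mulrC.
Qed.

Lemma fps_inv_out : {in [predC fps_unit], fps_inv =1 id}.
Proof. by move=> f /negbTE /= Uf; rewrite /fps_inv [fps_unit f]Uf. Qed.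

HB.instance Definition _ := GRing.ComNzRing_hasMulInverse.Build (fps R)
  fps_mulVx fps_unitPl fps_inv_out.

Lemma fps_unitE f : (f \is a GRing.unit) = (fcoef f 0 \is a GRing.unit).
Proof. by []. Qed.
End FpsUnitRing.

Definition king (n : nat) (s : 'S_n) : bool :=
  [forall i : 'I_n, forall j : 'I_n,
     (j == i.+1 :> nat) ==> (1 < `|(s j)%:Z - (s i)%:Z|)].

Definition kings (n : nat) : {set 'S_n} := [set s | king s].

(* 'I_n and 'S_n are 0-based; the grid lines below use the 1-based positions
   i.+1 and values (s i).+1, so that 0 and n.+1 are the outer lines. *)
Definition grid_line (n a b k : nat) : nat :=
  nth 0%N [:: 0; a.+1; b.+1; n.+1]%N k.

Definition mesh12_occ (R : {set 'I_3 * 'I_3}) (n : nat) (s : 'S_n)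
    (i1 i2 : 'I_n) : bool :=
  let pline := grid_line n i1 i2 in
  let vline := grid_line n (s i1) (s i2) in
  [&& (i1 < i2)%N, (s i1 < s i2)%N &
   [forall c in R, ~~ [exists m : 'I_n,
      (pline c.1 < m.+1 < pline c.1.+1)%N &&
      (vline c.2 < (s m).+1 < vline c.2.+1)%N]]].

Definition mesh12_count (R : {set 'I_3 * 'I_3}) (n : nat) (s : 'S_n) : nat :=
  #|[set ij : 'I_n * 'I_n | mesh12_occ R s ij.1 ij.2]|.

Definition king_avoiders (R : {set 'I_3 * 'I_3}) (n : nat) : {set 'S_n} :=
  [set s in kings n | mesh12_count R s == 0%N].

Definition king_gf (S : comNzRingType) : fps S := Fps (fun n => #|kings n|%:R).

Definition avoid_gf (R : {set 'I_3 * 'I_3}) : fps int :=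
  Fps (fun n => #|king_avoiders R n|%:R).

(* An element of Z[u][[t]], the indeterminate 'X of the coefficients being u. *)
Definition dist_gf (R : {set 'I_3 * 'I_3}) : fps {poly int} :=
  Fps (fun n => \sum_(s in kings n) 'X^(mesh12_count R s)).

Definition pat_boxes : {set 'I_3 * 'I_3} :=
  [set c | (val c.1, val c.2) \in
     [:: (0, 1); (0, 2); (1, 1); (1, 2); (2, 0)]%N].

Lemma king_gf_unit (S : comUnitRingType) : king_gf S \is a GRing.unit.
Proof.
rewrite fps_unitE /=; suff -> : #|kings 0| = 1%N by rewrite unitr1.
rewrite -[RHS](card_Sn 0) -cardsT; congr #|pred_of_set _|.
by apply/setP => s; rewrite !inE; apply/forallP => -[].
Qed.

(* Main.v *)
(** The boxes force an occurrence to consist of two consecutive left-to-right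
    maxima such that everything strictly before the second one is a permutation
    of an initial segment of the values.  Hence the occurrences correspond to the
    proper nonempty prefixes that permute an initial segment, and their number is
    one less than the number of direct-sum components.

    A direct sum of indecomposable permutations is a king permutation iff every
    component is one and no two consecutive components have length 1: an
    indecomposable permutation of length at least 2 neither starts with its
    minimum nor ends with its maximum.  Let [B] be the series of indecomposable
    kings of length at least 2, [W] that of all kings with weight [u] per
    component, and [H] the part of [W] whose first component is not of length 1.
    Splitting off the first component gives [W = H + utH] and [H = 1 + uBW], and
    [E = 1 + tH + BW], [P = 1 + t + B].  At [u = 1] this reads
    [A = (1 + t)(1 + BA)], which determines [B]. *)

Require Import Defs.
From mathcomp Require Import all_boot all_order all_algebra all_fingroup.
From mathcomp Require Import zify ring.
Import GRing.Theory.

Set Implicit Arguments.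
Unset Strict Implicit.
Unset Printing Implicit Defensive.

(** * Permutations as words, and prefixes that permute an initial segment *)

Definition perm_words (n : nat) : seq (seq nat) := permutations (iota 0 n).

Definition far : rel nat := fun a b => (a.+1 < b) || (b.+1 < a).

(** If [k] distinct entries lie below [k], they exhaust [0, ..., k-1]; so in the word of a
    permutation a cut within its length is a prefix permuting an initial segment. *)
Definition cut (l : seq nat) (k : nat) : bool :=
  all (fun x => x < k) (take k l).

(** Each direct-sum component ends at exactly one cut; the full length is always a cut, and the
    empty prefix is left out. *)
Definition ncomps (l : seq nat) : nat := count (cut l) (iota 1 (size l)).

(** For [a] of length [k], [a ++ shift k b] is the direct sum of [a] and [b]. *)
Definition shift (k : nat) : seq nat -> seq nat := map (addn k).

Lemma mem_perm_words (n : nat) (l : seq nat) :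
  (l \in perm_words n) = perm_eq l (iota 0 n).
Proof. exact: mem_permutations. Qed.

Lemma perm_words_uniq (n : nat) : uniq (perm_words n).
Proof. exact: permutations_uniq. Qed.

Section PermWord.
Variables (n : nat) (l : seq nat).
Hypothesis lP : l \in perm_words n.

Lemma size_perm_word : size l = n.
Proof. by move: lP; rewrite mem_perm_words => /perm_size ->; rewrite size_iota. Qed.

Lemma perm_word_uniq : uniq l.
Proof. by move: lP; rewrite mem_perm_words => /perm_uniq ->; exact: iota_uniq. Qed.

Lemma mem_perm_word (x : nat) : (x \in l) = (x < n).
Proof. by move: lP; rewrite mem_perm_words => /perm_mem ->; rewrite mem_iota. Qed.

Lemma cut_size : cut l n.
Proof.
rewrite /cut -size_perm_word take_size size_perm_word.
by apply/allP => x; rewrite mem_perm_word.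
Qed.

Lemma take_perm_word (k : nat) : k <= n -> cut l k -> take k l \in perm_words k.
Proof.
move=> lekn /allP cutk; rewrite mem_perm_words.
have Ut : uniq (take k l) by rewrite take_uniq ?perm_word_uniq.
have sub : {subset take k l <= iota 0 k}.
  by move=> x /cutk; rewrite mem_iota.
have [|_ eqi] := uniq_min_size Ut sub.
  by rewrite size_iota size_takel // size_perm_word.
by apply: uniq_perm => //; exact: iota_uniq.
Qed.

Lemma drop_perm_word (k : nat) : k <= n -> cut l k ->
  exists2 b, b \in perm_words (n - k) & drop k l = shift k b.
Proof.
move=> lekn cutk.
have /permPl tP : perm_eq (take k l) (iota 0 k).
  by rewrite -mem_perm_words take_perm_word.
have dP : perm_eq (drop k l) (iota k (n - k)).
  have: perm_eq (take k l ++ drop k l) (iota 0 k ++ iota k (n - k)).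
    rewrite cat_take_drop -{2}[k]add0n -iotaD subnKC //.
    by rewrite -mem_perm_words.
  by rewrite (permPl (perm_cat (introT permPl tP) (perm_refl _))) perm_cat2l.
have dE : drop k l = shift k [seq x - k | x <- drop k l].
  rewrite /shift -map_comp -[LHS]map_id; apply/esym/eq_in_map => x.
  by rewrite (perm_mem dP) mem_iota /= => /andP[lekx _]; rewrite subnKC.
exists [seq x - k | x <- drop k l] => //.
rewrite mem_perm_words (_ : iota 0 (n - k) = [seq x - k | x <- iota k (n - k)]).
  exact: perm_map.
have -> : iota k (n - k) = shift k (iota 0 (n - k)) by rewrite /shift -iotaDl addn0.
rewrite -map_comp -[LHS]map_id.
by apply: eq_map => x /=; rewrite addKn.
Qed.
End PermWord.

Lemma cat_perm_word (k m : nat) (a b : seq nat) :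
  a \in perm_words k -> b \in perm_words m -> a ++ shift k b \in perm_words (k + m).
Proof.
rewrite !mem_perm_words => aP bP; rewrite iotaD add0n; apply: perm_cat => //.
by rewrite -[X in iota X m]addn0 iotaDl perm_map.
Qed.

(* [first_cut [::] = 1]. *)
Definition first_cut (l : seq nat) : nat :=
  (find (cut l) (iota 1 (size l))).+1.

Lemma first_cutP (n : nat) (l : seq nat) (k : nat) : l \in perm_words n -> 0 < n ->
  reflect [/\ 0 < k <= n, cut l k & forall j, 0 < j < k -> ~~ cut l j]
          (first_cut l == k).
Proof.
move=> lP n0; rewrite /first_cut (size_perm_word lP).
have hn : has (cut l) (iota 1 n).
  by apply/hasP; exists n; rewrite ?(cut_size lP) // mem_iota; lia.
have fn := hn; rewrite has_find size_iota in fn.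
apply: (iffP eqP) => [<-|[kn ck nk]].
  split; first by lia.
    by have := nth_find 0 hn; rewrite nth_iota.
  move=> [|j] // /andP[_ jk]; have := @before_find _ 0 (cut l) (iota 1 n) j.
  by rewrite ltnS in jk; rewrite jk nth_iota ?(ltn_trans jk) // add1n => ->.
set f := find _ _ in fn *; case: (ltngtP f.+1 k) => // fk.
  have := nth_find 0 hn; rewrite nth_iota // add1n -/f.
  by rewrite (negbTE (nk _ _)) //; lia.
have := @before_find _ 0 (cut l) (iota 1 n) k.-1 ltac:(rewrite -/f; lia).
by rewrite nth_iota ?add1n ?prednK ?ck //; lia.
Qed.

(** * Splitting off the first component *)

Lemma cut_catl (k j : nat) (a b : seq nat) : j <= size a ->
  cut (a ++ shift k b) j = cut a j.
Proof. by move=> lej; rewrite /cut takel_cat. Qed.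

Lemma cut_catr (k j : nat) (a b : seq nat) : a \in perm_words k ->
  cut (a ++ shift k b) (k + j) = cut b j.
Proof.
move=> aP; rewrite /cut take_cat (size_perm_word aP) ltnNge leq_addr /= addKn.
rewrite all_cat -map_take all_map.
have -> : all (fun x => x < k + j) a.
  by apply/allP => x; rewrite (mem_perm_word aP); lia.
by apply: eq_all => x /=; rewrite ltn_add2l.
Qed.

(** As [a] is indecomposable, the only positive cut up to [k] is [k] itself; the later ones are the
    cuts of [b] moved by [k]. *)
Lemma ncomps_cat (k : nat) (a b : seq nat) : a \in perm_words k -> 0 < k ->
  first_cut a = k -> ncomps (a ++ shift k b) = (ncomps b).+1.
Proof.
move=> aP k0 /eqP/(first_cutP k aP k0)[_ ck nk].
rewrite /ncomps size_cat size_map (size_perm_word aP) iotaD count_cat -[RHS]add1n.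
congr addn.
  rewrite -(@eq_in_count _ (pred1 k)).
    by rewrite count_uniq_mem ?iota_uniq // mem_iota add1n k0 ltnS leqnn.
  move=> j; rewrite mem_iota => jk; rewrite /= cut_catl ?(size_perm_word aP); last lia.
  have [->|neq] := eqVneq j k; first by rewrite ck.
  by apply/esym/negbTE/nk; lia.
rewrite addnC iotaDl count_map; apply: eq_count => j.
by rewrite /= cut_catr.
Qed.

(** Were the last entry the maximum [k.-1], deleting it would leave a nonempty prefix that is a cut
    before [k]. *)
Lemma last_indec (k x : nat) (a : seq nat) : x :: a \in perm_words k -> 1 < k ->
  first_cut (x :: a) = k -> last x a < k.-1.
Proof.
move=> aP k1 /eqP/(first_cutP k aP (ltnW k1))[_ _ nk].
have sa := size_perm_word aP; have Ua := perm_word_uniq aP.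
have lt_k (z : nat) : z \in x :: a -> z < k by rewrite (mem_perm_word aP).
have lastk : last x a < k by apply: lt_k; exact: mem_last.
suff: last x a != k.-1 by lia.
apply/eqP => Ek; have /negP := nk k.-1 ltac:(lia); apply.
rewrite lastI in sa Ua lt_k *; rewrite size_rcons in sa.
rewrite /cut -sa /= -cats1 take_size_cat //.
apply/allP => z za; have := lt_k z; rewrite mem_rcons inE za orbT => /(_ isT).
move: Ua; rewrite rcons_uniq => /andP[+ _].
by have [Ez|] := eqVneq z (last x a); [rewrite -Ez za | lia].
Qed.

(** Only the junction matters. If [k > 1], the last entry of [a] is below [k - 1] and the next entry
    is at least [k]. If [k = 1], the last entry of [a] is 0 and the next must exceed 1; the default
    of [head] lets an empty [b] pass. *)
Lemma sorted_far_cat (k : nat) (a b : seq nat) : a \in perm_words k -> 0 < k ->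
  first_cut a = k ->
  sorted far (a ++ shift k b) =
    [&& sorted far a, sorted far b & (k == 1) ==> (head 1 b != 0)].
Proof.
move=> aP k0 fa.
case: a aP fa => [|x a] aP fa; first by move: k0; rewrite -(size_perm_word aP).
rewrite /= cat_path; congr (_ && _).
case: b => [|y b] /=; first by rewrite implybT.
have -> : path far (k + y) (map (addn k) b) = path far y b.
  by rewrite path_map; apply: eq_path => z t; rewrite /far /=; lia.
rewrite andbC; congr (_ && _).
have [k1|k1] := eqVneq k 1.
  have := mem_perm_word aP (last x a); rewrite k1 mem_last ltnS leqn0.
  by move=> /esym/eqP ->; rewrite /far; lia.
by have := last_indec aP ltac:(lia) fa; rewrite /far /=; lia.
Qed.

Lemma first_cut_words (n k : nat) : 0 < k <= n ->
  perm_eq [seq l <- perm_words n | first_cut l == k]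
    [seq a ++ shift k b | a <- [seq a <- perm_words k | first_cut a == k],
                          b <- perm_words (n - k)].
Proof.
move=> /andP[k0 lekn]; apply: uniq_perm.
- by rewrite filter_uniq ?perm_words_uniq.
- apply: allpairs_uniq; rewrite ?filter_uniq ?perm_words_uniq //.
  move=> [a b] [a' b'] /allpairsP[[? ?] [/= + _ [-> _]]] /allpairsP[[? ?] [/= + _ [-> _]]].
  rewrite !mem_filter => /andP[_ /size_perm_word sa] /andP[_ /size_perm_word sa'].
  move=> /= /eqP; rewrite eqseq_cat ?sa ?sa' // => /andP[/eqP -> /eqP E].
  by rewrite (inj_map (@addnI k) E).
move=> l; rewrite mem_filter; apply/idP/allpairsP => [/andP[fl lP]|[[a b]]].
  have /(first_cutP k lP (leq_trans k0 lekn))[_ ck nk] := fl.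
  have [b bP Eb] := drop_perm_word lP lekn ck.
  have aP := take_perm_word lP lekn ck.
  exists (take k l, b); split=> //=; last by rewrite -Eb cat_take_drop.
  rewrite mem_filter aP andbT; apply/(first_cutP k aP k0); split=> [||j jk].
  - by rewrite k0 leqnn.
  - exact: cut_size.
  by rewrite /cut take_takel ?nk //; lia.
rewrite mem_filter /= => -[/andP[fa aP] bP ->].
have lP := cat_perm_word aP bP; rewrite subnKC // in lP; rewrite lP andbT.
have /(first_cutP k aP k0)[_ ck nk] := fa.
apply/(first_cutP k lP (leq_trans k0 lekn)); split=> [||j jk].
- by rewrite k0.
- by rewrite cut_catl // (size_perm_word aP).
by rewrite cut_catl ?nk // (size_perm_word aP); lia.
Qed.

Local Open Scope ring_scope.

(** * Generating series by number of components *)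

Section GenSeries.
Variable R : comNzRingType.
Implicit Type F : nat -> R.

Definition comps_gf F : fps R :=
  Fps (fun n => \sum_(l <- perm_words n | sorted far l) F (ncomps l)).

(* The default value of [head] makes the empty word count. *)
Definition comps_gf_head_neq0 F : fps R :=
  Fps (fun n => \sum_(l <- perm_words n | sorted far l && (head 1%N l != 0%N))
                  F (ncomps l)).

Definition indec_gf : fps R :=
  Fps (fun n =>
    \sum_(l <- perm_words n | sorted far l && (1 < n)%N && (first_cut l == n)) 1).

Lemma sum_first_cut F n k : (0 < k <= n)%N ->
  \sum_(l <- perm_words n | sorted far l && (first_cut l == k)) F (ncomps l) =
  \sum_(a <- perm_words k | sorted far a && (first_cut a == k))
   \sum_(b <- perm_words (n - k) | sorted far b && ((k == 1%N) ==> (head 1%N b != 0%N)))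
     F (ncomps b).+1.
Proof.
move=> kn; have k0 : (0 < k)%N by lia.
under eq_bigl do rewrite andbC.
rewrite -big_filter_cond (perm_big _ (first_cut_words kn)) big_mkcond big_allpairs_dep big_filter.
rewrite [RHS]big_mkcondl /= big_seq_cond [RHS]big_seq_cond.
apply: eq_bigr => a /andP[aP /eqP fa].
under eq_bigr do rewrite (sorted_far_cat _ aP k0 fa) (ncomps_cat _ aP k0 fa).
by case: (sorted far a) => /=; [rewrite -big_mkcond | rewrite big1].
Qed.

Lemma first_cut_part F (P : pred (seq nat)) n :
  \sum_(l <- perm_words n.+1 | P l) F (ncomps l) =
  \sum_(k < n.+2) \sum_(l <- perm_words n.+1 | P l && (first_cut l == k)) F (ncomps l).
Proof.
(* [first_cut l] is at most [n.+1], so [inord] keeps its value; the range [k < n.+2] is that of the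
   Cauchy product. *)
rewrite big_seq_cond (partition_big (fun l => inord (first_cut l) : 'I_n.+2) predT) //=.
apply: eq_bigr => k _; rewrite [RHS]big_seq_cond; apply: eq_bigl => l.
rewrite -andbA; case: (boolP (l \in _)) => //= lP; congr (_ && _).
have /(first_cutP _ lP (ltn0Sn n))[/andP[_ le_n] _ _] := eqxx (first_cut l).
by rewrite -val_eqE /= inordK.
Qed.

Lemma first_cut_eq1 x l : (first_cut (x :: l) == 1%N) = (x == 0%N).
Proof. by rewrite /first_cut /= /cut /= take0 andbT; case: x. Qed.

Lemma indec_gf_small k : (k <= 1)%N -> fcoef indec_gf k = 0.
Proof.
by move=> lek; rewrite /= big1 // => l; rewrite ltnNge lek andbF.
Qed.

Lemma sum_indec F n k : (1 < k <= n)%N ->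
  \sum_(l <- perm_words n | sorted far l && (first_cut l == k)) F (ncomps l) =
  fcoef indec_gf k * fcoef (comps_gf (F \o succn)) (n - k)%N.
Proof.
move=> /andP[k1 lekn]; rewrite sum_first_cut ?(ltnW k1) //= k1 mulr_suml.
rewrite (gtn_eqF k1) /=; under eq_bigr do under eq_bigl do rewrite andbT.
by apply: eq_big => [l|l _]; rewrite ?andbT ?mul1r.
Qed.

(** A first component of length 1 needs a rest not starting with 0, a longer one allows any rest;
    the rest has one component fewer, hence [F \o succn]. An arbitrary weight [F] serves [A], [P]
    and [E] at once. *)
Lemma comps_gfE F : comps_gf F =
  fpsC (F 0%N) + fpsX R * comps_gf_head_neq0 (F \o succn)
    + indec_gf * comps_gf (F \o succn).
Proof.
apply/fpsP => -[|n].
  by rewrite !fcoefD !fcoefM !big_ord1 /= !big_cons !big_nil /= !mul0r !addr0.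
rewrite !fcoefD !fcoefM -addrA -big_split [LHS]first_cut_part [fcoef (fpsC _) _]/= add0r.
(* The term [k = 0] vanishes, [k = 1] comes from [fpsX] alone, and larger [k] from [indec_gf]
   alone. *)
apply: eq_bigr => -[[|[|k]] ltk] _; rewrite -[RHS]/(_ + _) [fcoef (fpsX R) _]/=.
- by rewrite indec_gf_small // !mul0r addr0 big1 // => l; rewrite andbF.
- rewrite indec_gf_small // mul0r addr0 mul1r sum_first_cut //.
  by rewrite big_cons big_nil /= addr0 subn1.
by rewrite mul0r add0r sum_indec.
Qed.

(** A nonempty word starts with 0 exactly when its first component has length 1, so the term [k = 1]
    drops out. *)
Lemma comps_gf_head_neq0E F : comps_gf_head_neq0 F =
  fpsC (F 0%N) + indec_gf * comps_gf (F \o succn).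
Proof.
apply/fpsP => -[|n].
  by rewrite !fcoefD !fcoefM !big_ord1 /= !big_cons !big_nil /= !mul0r !addr0.
rewrite !fcoefD !fcoefM [LHS]first_cut_part [fcoef (fpsC _) _]/= add0r.
have headE l : l \in perm_words n.+1 -> (head 1%N l != 0%N) = (first_cut l != 1%N).
  by case: l => [/size_perm_word|x l _] //; rewrite first_cut_eq1.
apply: eq_bigr => -[k ltk] _; rewrite [val _]/=.
have -> : \sum_(l <- perm_words n.+1 | sorted far l && (head 1%N l != 0%N) && (first_cut l == k))
    F (ncomps l) =
  \sum_(l <- perm_words n.+1 | (k != 1%N) && (sorted far l && (first_cut l == k))) F (ncomps l).
  rewrite big_seq_cond [RHS]big_seq_cond; apply: eq_bigl => l.
  case: (boolP (l \in _)) => //= lP; rewrite headE // andbAC andbC.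
  by case: (first_cut l =P k) => [->|_]; rewrite ?andbF.
case: k ltk => [|[|k]] ltk.
- by rewrite indec_gf_small // mul0r big1 // => l; rewrite andbF.
- by rewrite indec_gf_small // mul0r big1.
by rewrite sum_indec.
Qed.
End GenSeries.

(** * Permutations and their words: kings, cuts and occurrences *)

Lemma card_ord_lt n k : (k <= n)%N -> #|[set i : 'I_n | (i < k)%N]| = k.
Proof.
move=> lek; rewrite -sum1_card; under eq_bigl do rewrite inE.
by rewrite -(big_ord_widen n (fun=> 1%N) lek) sum1_card card_ord.
Qed.

Section PermToWord.
Variable n : nat.
Implicit Type s : 'S_n.

Definition word s : seq nat := [seq val (s i) | i <- enum 'I_n].

Lemma size_word s : size (word s) = n.
Proof. by rewrite size_map size_enum_ord. Qed.

Lemma nth_word s (i : 'I_n) : nth 0%N (word s) i = s i.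
Proof. by rewrite (nth_map i) ?size_enum_ord // nth_ord_enum. Qed.

Lemma word_inj : injective word.
Proof. by move=> s s' E; apply/permP => i; apply: val_inj; rewrite /= -!nth_word E. Qed.

Lemma word_perm s : word s \in perm_words n.
Proof.
rewrite mem_perm_words; apply: uniq_perm; rewrite ?iota_uniq //.
  by rewrite map_inj_uniq ?enum_uniq // => i j /val_inj/perm_inj.
move=> x; rewrite mem_iota add0n; apply/mapP/idP => [[i _ ->]|ltx]; first exact: ltn_ord.
by exists ((s^-1)%g (Ordinal ltx)); rewrite ?mem_enum // permKV.
Qed.

Lemma perm_words_word : perm_eq [seq word s | s <- enum 'S_n] (perm_words n).
Proof.
have Uw : uniq [seq word s | s <- enum 'S_n] by rewrite map_inj_uniq ?enum_uniq //; exact: word_inj.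
have sub : {subset [seq word s | s <- enum 'S_n] <= perm_words n}.
  by move=> _ /mapP[s _ ->]; exact: word_perm.
have [|_ eqi] := uniq_min_size Uw sub.
  rewrite size_permutations ?iota_uniq // size_iota size_map -cardE.
  by rewrite card_Sn.
by apply: uniq_perm => //; exact: perm_words_uniq.
Qed.

Lemma king_word s : king s = sorted far (word s).
Proof.
apply/'forall_forallP/(sortedP 0%N) => [ks i|sw i j].
  rewrite size_word => lti.
  have := ks (Ordinal (ltnW lti)) (Ordinal lti); rewrite eqxx /=.
  rewrite -(nth_word s (Ordinal lti)) -(nth_word s (Ordinal (ltnW lti))) /far /=; lia.
apply/implyP => /eqP Ej; have := sw i; rewrite size_word -Ej ltn_ord !nth_word => /(_ isT).
rewrite /far; lia.
Qed.

Lemma cut_word s k : (k <= n)%N ->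
  reflect (forall i : 'I_n, (i < k)%N -> (s i < k)%N) (cut (word s) k).
Proof.
move=> lek; apply: (iffP (all_nthP 0%N)); rewrite size_takel ?size_word // => H i lti.
  by have := H i lti; rewrite nth_take // nth_word.
have ltin := leq_trans lti lek.
by rewrite nth_take // -[i]/(val (Ordinal ltin)) nth_word H.
Qed.

(** An injection of the positions below [k] into themselves is onto, so no later position takes a
    value below [k]. *)
Lemma cut_word_iff s k : (k <= n)%N -> cut (word s) k ->
  forall i : 'I_n, (s i < k)%N = (i < k)%N.
Proof.
move=> lek /(cut_word _ lek) H.
have /eqP E : s @: [set i : 'I_n | (i < k)%N] == [set i : 'I_n | (i < k)%N].
  rewrite eqEcard card_imset ?leqnn ?andbT; last exact: perm_inj.
  by apply/subsetP => _ /imsetP[i + ->]; rewrite !inE; exact: H.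
move=> i; have := mem_imset [set i : 'I_n | (i < k)%N] i (@perm_inj _ s).
by rewrite E !inE.
Qed.

(** The boxes in columns 0 and 1 keep every value before [i2] at or below [s i1]; box [(2, 0)] puts
    every value below [s i1] before [i2]. *)
Lemma mesh12_occ_pat s (i1 i2 : 'I_n) :
  mesh12_occ pat_boxes s i1 i2 =
  [&& (0 < i2)%N, cut (word s) i2 & (s i1).+1 == i2 :> nat].
Proof.
apply/and3P/and3P => -[].
  move=> lti lts /forall_inP H.
  have box (x y : 'I_3) (m : 'I_n) :
    (val x, val y) \in [:: (0, 1); (0, 2); (1, 1); (1, 2); (2, 0)]%N ->
    (grid_line n i1 i2 x < m.+1 < grid_line n i1 i2 x.+1)%N ->
    (grid_line n (s i1) (s i2) y < (s m).+1 < grid_line n (s i1) (s i2) y.+1)%N -> False.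
    move=> xyR hp hv; have /negP := H (x, y) ltac:(by rewrite inE); apply.
    by apply/existsP; exists m; rewrite hp.
  have b01 m := box (@Ordinal 3 0 isT) (@Ordinal 3 1 isT) m isT.
  have b02 m := box (@Ordinal 3 0 isT) (@Ordinal 3 2 isT) m isT.
  have b11 m := box (@Ordinal 3 1 isT) (@Ordinal 3 1 isT) m isT.
  have b12 m := box (@Ordinal 3 1 isT) (@Ordinal 3 2 isT) m isT.
  have b20 m := box (@Ordinal 3 2 isT) (@Ordinal 3 0 isT) m isT.
  rewrite /grid_line /= in b01 b02 b11 b12 b20.
  have inj m m' : s m = s m' :> nat -> m = m' :> nat.
    by move=> /val_inj/perm_inj ->.
  have s_eq (m m' : 'I_n) : m = m' :> nat -> s m = s m' :> nat by move=> /val_inj ->.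
  have below (m : 'I_n) : (m < i2)%N -> (s m <= s i1)%N.
    move: (b01 m) (b02 m) (b11 m) (b12 m) (s_eq m i1) (inj m i2) (ltn_ord (s m)); lia.
  have left (m : 'I_n) : (s m <= s i1)%N -> (m < i2)%N.
    move: (b20 m) (s_eq m i2) (inj m i1) (ltn_ord m); lia.
  (* The positions before [i2] are exactly those with values up to [s i1]; both sets are counted. *)
  have E : i2 = (s i1).+1 :> nat.
    rewrite -[LHS](card_ord_lt (ltnW (ltn_ord i2))) -[RHS](card_ord_lt (ltn_ord (s i1))).
    rewrite -[RHS](card_preimset _ (@perm_inj _ s)); apply: eq_card => m.
    by rewrite !inE ltnS; apply/idP/idP; [exact: below | exact: left].
  split; first by lia.
    by apply/(cut_word _ (ltnW (ltn_ord i2))) => m /below; rewrite E ltnS.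
  by rewrite E.
(* Conversely, [i1] carries the maximum of a prefix permuting an initial segment, and [iff] empties
   all five boxes. *)
move=> i20 ci /eqP E; have iff := cut_word_iff (ltnW (ltn_ord i2)) ci.
have lti : (i1 < i2)%N by rewrite -iff; lia.
have lts : (s i1 < s i2)%N by have := iff i2; lia.
split=> //.
apply/forall_inP => -[x y]; rewrite inE /= => xyR; apply/existsP => -[m /andP[]].
have := iff m.
move: xyR; rewrite /grid_line !inE !xpair_eqE.
move=> /orP[|/orP[|/orP[|/orP[]]]] /andP[/eqP -> /eqP ->] /=; lia.
Qed.

(** An occurrence is determined by [i2], which ranges over the cuts strictly between 0 and [n]; the
    predecessor removes the cut at [n]. *)
Lemma mesh12_count_pat s : mesh12_count pat_boxes s = (ncomps (word s)).-1.
Proof.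
rewrite /mesh12_count.
pose D := [set j : 'I_n | (0 < j)%N && cut (word s) j].
have lt_pred (j : 'I_n) : (j.-1 < n)%N by rewrite (leq_ltn_trans (leq_pred _)).
(* The first point of the occurrence sits where the value [j - 1] is taken. *)
pose f (j : 'I_n) := ((s^-1)%g (Ordinal (lt_pred j)), j).
have -> : [set ij | mesh12_occ pat_boxes s ij.1 ij.2] = f @: D.
  apply/setP => -[i1 i2]; rewrite inE mesh12_occ_pat /=.
  apply/and3P/imsetP => [[i20 ci /eqP E]|[j + [-> ->]]].
    exists i2; rewrite ?inE ?i20 //; congr (_, _).
    by apply: (@perm_inj _ s); rewrite permKV; apply: val_inj; rewrite /= -E.
  by rewrite inE => /andP[j0 cj]; rewrite j0 cj permKV /= prednK.
rewrite card_imset => [|j j' []//].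
rewrite /ncomps size_word.
have [n0|n0] := posnP n.
  have -> : D = set0 by apply/setP => -[j ltj]; lia.
  by rewrite cards0 [X in iota 1 X]n0.
have -> : iota 1 n = rcons (iota 1 n.-1) n.
  by rewrite -cats1 -[X in [:: X]](prednK n0) -add1n -(iotaD 1 n.-1 1) addn1 prednK.
rewrite -cats1 count_cat /= (cut_size (word_perm s)) addn0 addn1 /=.
rewrite -sum1_card -sum1_count; under eq_bigl do rewrite inE.
rewrite -(big_mkord (fun j => (0 < j)%N && cut (word s) j) (fun=> 1%N)).
by rewrite big_ltn_cond //= /index_iota subn1 big_seq_cond [RHS]big_seq_cond;
  apply: eq_bigl => j; rewrite mem_iota; case: j.
Qed.

Lemma sum_kings (R : comNzRingType) (F : nat -> R) :
  \sum_(s in kings n) F (mesh12_count pat_boxes s) =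
  \sum_(l <- perm_words n | sorted far l) F (ncomps l).-1.
Proof.
rewrite -(perm_big _ perm_words_word) big_map big_enum_cond /=.
apply: eq_big => [s|s _]; first by rewrite inE king_word.
by rewrite mesh12_count_pat.
Qed.
End PermToWord.

(** * Identities for [A], [P] and [E] *)

Section GenSeriesIdentities.
Variable R : comNzRingType.

Lemma comps_gfZ (c : R) (F G : nat -> R) :
  (forall k, G k = c * F k) -> comps_gf G = fpsC c * comps_gf F.
Proof.
move=> GE; apply/fpsP => n; rewrite fcoefM big_ord_recl big1 => [|i _]; last by rewrite mul0r.
by rewrite addr0 subn0 /= mulr_sumr; apply: eq_bigr => l _.
Qed.

Lemma comps_gf_head_neq0Z (c : R) (F G : nat -> R) :
  (forall k, G k = c * F k) -> comps_gf_head_neq0 G = fpsC c * comps_gf_head_neq0 F.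
Proof.
move=> GE; apply/fpsP => n; rewrite fcoefM big_ord_recl big1 => [|i _]; last by rewrite mul0r.
by rewrite addr0 subn0 /= mulr_sumr; apply: eq_bigr => l _.
Qed.

(** Once a component is split off, the weight vanishes identically, so only the empty word
    remains. *)
Lemma comps_gf_eq0 :
  comps_gf (fun c => (c == 0%N)%:R) = 1 :> fps R /\
  comps_gf_head_neq0 (fun c => (c == 0%N)%:R) = 1 :> fps R.
Proof.
have gf0 : comps_gf (fun c => (c.+1 == 0%N)%:R) = 0 :> fps R.
  by apply/fpsP => n; rewrite /= big1.
have gf_head0 : comps_gf_head_neq0 (fun c => (c.+1 == 0%N)%:R) = 0 :> fps R.
  by apply/fpsP => n; rewrite /= big1.
by split; rewrite (comps_gfE, comps_gf_head_neq0E) /comp gf0 ?gf_head0 !mulr0 !addr0.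
Qed.

Lemma king_gf_comps : king_gf R = comps_gf (fun=> 1).
Proof.
by apply/fpsP => n; rewrite /= -(sum_kings _ (fun=> 1)) sumr_const.
Qed.

Lemma king_gf_indec :
  king_gf R = (1 + fpsX R) * (1 + indec_gf R * king_gf R).
Proof.
rewrite king_gf_comps {1}comps_gfE comps_gf_head_neq0E /comp -[fpsC 1]/(1 : fps R); ring.
Qed.
End GenSeriesIdentities.

(** Avoiders have at most one component: after the first one, the weight becomes the indicator of an
    empty rest. *)
Lemma avoid_gf_indec : avoid_gf pat_boxes = 1 + fpsX int + indec_gf int.
Proof.
have -> : avoid_gf pat_boxes = comps_gf (fun c => (c.-1 == 0%N)%:R).
  apply/fpsP => n; rewrite /= -(sum_kings _ (fun c => (c == 0%N)%:R)).
  rewrite -sum1_card natr_sum big_mkcond [RHS]big_mkcond /=.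
  by apply: eq_bigr => s _; rewrite inE; case: (s \in _); case: eqP.
have [gf1 gf_head1] := comps_gf_eq0 int.
by rewrite comps_gfE /comp /= gf1 gf_head1 !mulr1.
Qed.

Lemma dist_gf_indec :
  dist_gf pat_boxes = 1 + fpsX {poly int} * comps_gf_head_neq0 (fun c => 'X^c)
                        + indec_gf {poly int} * comps_gf (fun c => 'X^c).
Proof.
have -> : dist_gf pat_boxes = comps_gf (fun c => 'X^(c.-1)).
  by apply/fpsP => n; rewrite /= (sum_kings _ (fun c => 'X^c)).
exact: comps_gfE.
Qed.

(** Eliminating [W] gives [H * (1 - u * B * (1 + u * t)) = 1]. Multiplied by [(1 + t) * A], the
    bracket becomes the denominator [D], since [(1 + t) * B * A = A - (1 + t)]; hence
    [H * D = (1 + t) * A]. Then [E = 1 + (t + B * (1 + u * t)) * H] is multiplied by [D]. *)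
Lemma dist_identity (R : comNzRingType) (t u A B W H E : R) :
  A = (1 + t) * (1 + B * A) ->
  W = 1 + t * (u * H) + B * (u * W) -> H = 1 + B * (u * W) ->
  E = 1 + t * H + B * W ->
  E * (u * (1 + u * t) * (1 + t) + (1 - u) * (1 + t + u * t) * A) =
  (-1 + u) * (1 + u * t) * (1 + t) + (2 - u + t * (2 + t + u - u ^+ 2)) * A.
Proof.
move=> AE WE HE EE.
have BA : (1 + t) * (B * A) = A - (1 + t) by rewrite {2}AE; ring.
have WH : W = (1 + u * t) * H by rewrite [LHS]WE mulrDl mul1r {2}HE; ring.
set D := (X in E * X = _).
have DH : H * D = A * (1 + t).
  have DE : D = A * (1 + t) - u * (1 + u * t) * ((1 + t) * (B * A)).
    by rewrite BA /D; ring.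
  have -> : H * D = (H - B * (u * W)) * (A * (1 + t)) by rewrite DE WH; ring.
  by rewrite {1}HE addrK mul1r.
have -> : E * D = D + (t + B * (1 + u * t)) * (H * D) by rewrite EE WH; ring.
have -> : (t + B * (1 + u * t)) * (H * D) =
    t * (1 + t) * A + (1 + u * t) * ((1 + t) * (B * A)) by rewrite DH; ring.
by rewrite BA /D; ring.
Qed.

(** * Initial coefficients by enumeration *)

Definition comp_counts (n : nat) : seq nat :=
  [seq (ncomps l).-1 | l <- perm_words n & sorted far l].

Lemma sum_exp_count (R : comNzRingType) (x : R) (N : nat) (s : seq nat) :
  all (fun c => c < N)%N s ->
  \sum_(c <- s) x ^+ c = \sum_(k < N) (count_mem (val k) s)%:R * x ^+ k.
Proof.
elim: s => [_|c s IHs /= /andP[ltc /IHs IH]].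
  by rewrite big_nil big1 // => k _; rewrite mul0r.
rewrite big_cons IH; under [RHS]eq_bigr do rewrite natrD mulrDl.
rewrite big_split /=; congr (_ + _).
rewrite (bigD1 (Ordinal ltc)) //= eqxx mul1r big1 ?addr0 // => k neq.
by rewrite -val_eqE /= eq_sym in neq; rewrite (negbTE neq) mul0r.
Qed.

(** Reduces a coefficient to tallies in a list of naturals, which can be evaluated; three tallies
    suffice when no king of length [n] has more than two occurrences. *)
Lemma dist_gf_coef (n c0 c1 c2 : nat) :
  let s := comp_counts n in
  [&& all (fun c => c < 3)%N s, count_mem 0%N s == c0,
      count_mem 1%N s == c1 & count_mem 2%N s == c2] ->
  fcoef (dist_gf pat_boxes) n = c0%:R + c1%:R * 'X + c2%:R * 'X ^+ 2.
Proof.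
move=> s /and4P[lt3 /eqP <- /eqP <- /eqP <-].
rewrite /= (sum_kings _ (fun c => 'X^c)) -big_filter.
rewrite -(big_map (fun l => (ncomps l).-1) predT (fun c => 'X^c)).
by rewrite (sum_exp_count _ lt3) !big_ord_recl big_ord0 /= addr0 mulr1 addrA.
Qed.

Theorem theorem4p8 :
  [/\ (let t := fpsX int in
       let A := king_gf int in
       avoid_gf pat_boxes = 1 + t + (1 + t)^-1 - A^-1),
      (let t := fpsX {poly int} in
       let u := fpsC ('X : {poly int}) in
       let A := king_gf {poly int} in
       dist_gf pat_boxes =
         ((-1 + u) * (1 + u * t) * (1 + t)
            + (2 - u + t * (2 + t + u - u ^+ 2)) * A)
         / (u * (1 + u * t) * (1 + t) + (1 - u) * (1 + t + u * t) * A)) &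
      (let u := 'X : {poly int} in
       [seq fcoef (dist_gf pat_boxes) n | n <- iota 0 9] =
         [:: 1; 1; 0; 0; 2; 10 + 4 * u; 68 + 20 * u + 2 * u ^+ 2;
             500 + 136 * u + 10 * u ^+ 2; 4170 + 1004 * u + 68 * u ^+ 2])].
Proof.
split=> [t A | t u A | u].
- have Ut : 1 + t \is a GRing.unit by rewrite fps_unitE fcoefD fcoef1 /= addr0 unitr1.
  have UA : A \is a GRing.unit := king_gf_unit int.
  rewrite avoid_gf_indec -!addrA; congr (_ + (_ + _)).
  (* Clearing both inverses leaves [(1 + t) * B * A = A - (1 + t)], with [B] the series
     [indec_gf]. *)
  apply: (mulrI Ut); apply: (mulIr UA).
  have AE := king_gf_indec int; rewrite -/A -/t in AE.
  rewrite mulrBr mulrV // mulrBl mul1r mulrVK // {2}AE; ring.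
- have A0 : fcoef A 0 = 1.
    by rewrite /A king_gf_comps /= !big_cons big_nil addr0.
  (* The denominator is a unit: its constant coefficient is [u + (1 - u) = 1]. *)
  apply: canRL (mulrK _) _.
    rewrite fps_unitE !fcoefD !fcoef0M !fcoefD !fcoefN !fcoef0M A0 !fcoef1 /=.
    rewrite !mulr0 !addr0 !mulr1 subrKC; exact: unitr1.
  apply: dist_identity (king_gf_indec _) _ _ dist_gf_indec.
    rewrite [LHS]comps_gfE; congr (_ + _ * _ + _ * _).
      by apply: comps_gf_head_neq0Z => k; exact: exprS.
    by apply: comps_gfZ => k; exact: exprS.
  rewrite [LHS]comps_gf_head_neq0E; congr (_ + _ * _).
  by apply: comps_gfZ => k; exact: exprS.
rewrite [iota 0 9]/= !map_cons [map _ [::]]/=.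
rewrite (@dist_gf_coef 0 1 0 0); last by vm_compute.
rewrite (@dist_gf_coef 1 1 0 0); last by vm_compute.
rewrite (@dist_gf_coef 2 0 0 0); last by vm_compute.
rewrite (@dist_gf_coef 3 0 0 0); last by vm_compute.
rewrite (@dist_gf_coef 4 2 0 0); last by vm_compute.
rewrite (@dist_gf_coef 5 10 4 0); last by vm_compute.
rewrite (@dist_gf_coef 6 68 20 2); last by vm_compute.
rewrite (@dist_gf_coef 7 500 136 10); last by vm_compute.
rewrite (@dist_gf_coef 8 4170 1004 68); last by vm_compute.
by rewrite !mul0r !addr0.
Qed.
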